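(* Let $\beta>0$ and let $G,a,V$ satisfy: (1) $G:\mathbb{R}\to[0,+\infty)$ is locally Lipschitz continuous and $\lim_{p\to\pm\infty}G(p)=+\infty$; (2) $G(0)=0$, $G_1:=G|_{(-\infty,0]}$ is strictly decreasing and $G_2:=G|_{[0,+\infty)}$ is strictly increasing; (3) $a:\mathbb{R}\times\Omega\to(0,1]$ and $V:\mathbb{R}\times\Omega\to[0,1]$ are stationary, i.e. $a(x,\omega)=a(0,\tau_x\omega)$ and $V(x,\omega)=V(0,\tau_x\omega)$ for every $(x,\omega)\in\mathbb{R}\times\Omega$; (4) $\inf_{x\in\mathbb{R}}V(x,\omega)=0$ and $\sup_{x\in\mathbb{R}}V(x,\omega)=1$ for $\mathbb{P}$-a.e. $\omega$; (5) $a(\cdot,\omega)$ and $V(\cdot,\omega)$ are continuous on $\mathbb{R}$ for every $\omega\in\Omega$. With $F_1^\lambda,F_2^\lambda$ as defined in the context, set, for $\lambda\ge\beta$, $$\theta_1(\lambda):=\mathbb{E}[(F_1^\lambda)'(0,\omega)]\quad\text{and}\quad\theta_2(\lambda):=\mathbb{E}[(F_2^\lambda)'(0,\omega)].$$ Then $$\theta_1(\lambda)\in(G_1^{-1}(\lambda),G_1^{-1}(\lambda-\beta))\quad\text{and}\quad\theta_2(\lambda)\in(G_2^{-1}(\lambda-\beta),G_2^{-1}(\lambda))$$ for every $\lambda\ge\beta$. These quantities define two continuous bijections $$\theta_1:[\beta,+\infty)\to(-\infty,\theta_1(\beta)]\quad\text{and}\quad\theta_2:[\beta,+\infty)\to[\theta_2(\beta),+\infty)$$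 which are decreasing and increasing, respectively. Moreover, their inverses $\theta_1^{-1}$ and $\theta_2^{-1}$ are locally Lipschitz continuous on their domains.
   Context: $(\Omega,\mathcal{F},\mathbb{P})$ is a probability space equipped with a group of measure-preserving transformations $\tau_x:\Omega\to\Omega$, $x\in\mathbb{R}$ (so $\tau_0=\mathrm{id}$, $\tau_{x+y}=\tau_x\circ\tau_y$), such that $(x,\omega)\mapsto\tau_x\omega$ is measurable, and $\mathbb{P}$ is ergodic: $\mathbb{P}(A)\in\{0,1\}$ whenever $A\in\mathcal{F}$ satisfies $\tau_xA=A$ for all $x\in\mathbb{R}$. $\mathbb{E}$ is expectation under $\mathbb{P}$. The functions $a(0,\cdot)$ and $V(0,\cdot)$ are measurable. $G_1^{-1}:[0,+\infty)\to(-\infty,0]$ and $G_2^{-1}:[0,+\infty)\to[0,+\infty)$ denote the inverses of $G_1$ and $G_2$. For $\lambda\ge\beta$ and $\omega\in\Omega$, consider the equation $a(x,\omega)F''+G(F')+\beta V(x,\omega)=\lambda$, $x\in\mathbb{R}$. Under (1)–(5) it is known that this equation has a unique solution $F_1^\lambda(\cdot,\omega)\in C^2(\mathbb{R})$ with $F_1^\lambda(0,\omega)=0$ and $(F_1^\lambda)'(x,\omega)\in[G_1^{-1}(\lambda),G_1^{-1}(\lambda-\beta)]$ for all $x\in\mathbb{R}$, and a unique solution $F_2^\lambda(\cdot,\omega)\in C^2(\mathbb{R})$ with $F_2^\lambda(0,\omega)=0$ and $(F_2^\lambda)'(x,\omega)\in[G_2^{-1}(\lambda-\beta),G_2^{-1}(\lambda)]$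 for all $x\in\mathbb{R}$; moreover $(F_i^\lambda)'(x,\omega)=(F_i^\lambda)'(0,\tau_x\omega)$ for $i\in\{1,2\}$ and all $x,\omega$. *)

(* Defs.v *)
From HB Require Import structures.
From mathcomp Require Import all_boot all_order all_algebra.
From mathcomp Require Import all_classical all_reals all_analysis.

Set Implicit Arguments.
Unset Strict Implicit.
Unset Printing Implicit Defensive.

Import Order.TTheory GRing.Theory Num.Theory.
Import numFieldNormedType.Exports.

Local Open Scope classical_set_scope.
Local Open Scope ring_scope.

Definition measure_preserving_flow (R : realType) (d : measure_display)
    (Omega : measurableType d) (P : probability Omega R)
    (tau : R -> Omega -> Omega) : Prop :=
  [/\ tau 0 = id,
      forall x y, tau (x + y) = tau x \o tau y,
      measurable_fun setT (fun z : R * Omega => tau z.1 z.2) &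
      forall x A, measurable A -> P (tau x @^-1` A) = P A].

Definition ergodic (R : realType) (d : measure_display)
    (Omega : measurableType d) (P : probability Omega R)
    (tau : R -> Omega -> Omega) : Prop :=
  forall A, measurable A -> (forall x, tau x @` A = A) ->
    P A = 0%E \/ P A = 1%E.

Definition stationary (R : realType) (Omega : Type)
    (tau : R -> Omega -> Omega) (f : R -> Omega -> R) : Prop :=
  forall x w, f x w = f 0 (tau x w).

(* The library's [locally Lipschitz] quantifies over neighbourhoods of all pairs
   (x, y) in A * A; near x = y this is the Lipschitz condition on a relative
   neighbourhood of x, and near x != y it follows from continuity. *)
Definition locally_lipschitz_on (R : realType) (A : set R) (f : R -> R) : Prop :=
  [locally [lipschitz f x | x in A]].

Definition C2 (R : realType) (f : R -> R) : Prop :=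
  [/\ forall x, derivable f x 1,
      forall x, derivable (derive1 f) x 1 &
      continuous (derive1n 2 f)].

(* Inverse of the restriction of f to A; only meaningful on f @` A, for f
   injective on A. *)
Definition inv_on (R : realType) (A : set R) (f : R -> R) : R -> R :=
  'pinv_(fun=> 0) A f.

Definition G1inv (R : realType) (G : R -> R) : R -> R := inv_on `]-oo, 0] G.
Definition G2inv (R : realType) (G : R -> R) : R -> R := inv_on `[0, +oo[ G.

(* For one fixed environment: a and V are here functions of x alone, and I is
   the interval in which the derivative of the solution F has to stay. *)
Definition corrector (R : realType) (beta : R) (G a V : R -> R) (lam : R)
    (I : interval R) (F : R -> R) : Prop :=
  [/\ C2 F,
      F 0 = 0,
      forall x, derive1 F x \in I &
      forall x, a x * derive1n 2 F x + G (derive1 F x) + beta * V x = lam].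

(* The integrand is bounded and, the corrector being unique, measurable, so the
   expectation is finite and fine only changes its type. *)
Definition theta (R : realType) (d : measure_display)
    (Omega : measurableType d) (P : probability Omega R)
    (F : R -> R -> Omega -> R) (lam : R) : R :=
  fine ('E_P[fun w => derive1 (fun x => F lam x w) 0])%E.

(* Main.v *)
(* The slope [u = F'] of a corrector is a bounded solution on the whole line of
   [a u' + G(u) + beta V = lam]. On the increasing branch of [G] two such slopes
   cannot separate: wherever [u2 - u1] exceeds a threshold, it would have to grow
   at least linearly backwards in time. Hence slopes are unique, so stationary,
   and they depend on [lam] in a way that is pointwise controlled from above by
   the modulus of strict monotonicity of [G] and from below by its Lipschitz
   constant: the former gives the continuity of [theta], the latter its strict
   monotonicity and the Lipschitz bound on its inverse. The same contraction
   makes explicit Euler schemes started at time [-n] converge to the slope at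
   time 0, which is therefore measurable. The mean slope cannot be an endpoint of
   its interval, since a constant slope would force [V] to be constant. The
   decreasing branch reduces to the increasing one by reflecting [x] and [p]. *)
Require Import Defs.
From HB Require Import structures.
From mathcomp Require Import all_boot all_order all_algebra.
From mathcomp Require Import all_classical all_reals all_analysis.
From mathcomp Require Import measurable_realfun.
From mathcomp Require Import lra ring.

Import Order.TTheory GRing.Theory Num.Theory.
Import numFieldNormedType.Exports.

Local Open Scope classical_set_scope.
Local Open Scope ring_scope.

Set Implicit Arguments.
Unset Strict Implicit.

(** * Differential inequalities, Lipschitz bounds and uniform gaps on the real line *)

Lemma derive1_lt0_left (R : realType) (f : R -> R) (x : R) :
  derivable f x 1 -> derive1 f x < 0 ->
  exists2 e, 0 < e & forall y, x - e < y < x -> f x < f y.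
Proof.
move=> /derivable1_diffP /diff_derivable df dfx.
have {}df : h^-1 *: (f (h + x) - f x) @[h --> 0^'] --> derive1 f x.
  rewrite derive1E; apply: cvg_trans (df 1).
  apply: near_eq_cvg; near=> h; by rewrite /= [h *: 1]mulr1.
have : \forall h \near 0^', h^-1 *: (f (h + x) - f x) < 0 by exact: cvgr_lt df _ dfx.
rewrite near_withinE => -[e /= e0 He]; exists e => // y /andP[yl yr].
have := He (y - x); rewrite /ball_ /= sub0r normrN ltr0_norm ?subr_lt0// subrK.
rewrite subr_eq0 lt_eqF// => /(_ _ isT).
rewrite [_ *: _]mulrC.
have : (y - x)^-1 < 0 by rewrite invr_lt0 subr_lt0.
move=> yx /(_ ltac:(lra)); nra.
Unshelve. all: by end_near. Qed.

(* Backwards in time [w] would have to grow at least linearly above [s]. *)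
Lemma le_of_derive1_le (R : realType) (w : R -> R) (B c s : R) :
  (forall x, derivable w x 1) -> (forall x, `|w x| <= B) -> 0 < c ->
  (forall x, s < w x -> derive1 w x <= - c) -> forall x, w x <= s.
Proof.
move=> dw wB c0 ws x0; rewrite leNgt; apply/negP => sw.
have cw (i : interval R) : {within [set` i], continuous w}.
  by apply: derivable_within_continuous => x _.
(* If [w y < w x0], the maximum of [w] on [[y, x0]] is attained at some [m > y] with [w m > s];
   there [w] has negative derivative, so it is larger just to the left of [m]. *)
have back y : y <= x0 -> w x0 <= w y.
  move=> yx0; rewrite leNgt; apply/negP => wyx.
  have [m myx mmax] := EVT_max yx0 (cw _).
  have wxm : w x0 <= w m by apply: mmax; rewrite in_itv/= yx0 lexx.
  have ym : y < m.
    rewrite lt_neqAle; move: (myx); rewrite in_itv/= => /andP[-> _].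
    by rewrite andbT; apply: contraTneq wxm => <-; rewrite -ltNge.
  have [e e0 He] : exists2 e, 0 < e & forall z, m - e < z < m -> w m < w z.
    apply: derive1_lt0_left => //; apply: (le_lt_trans (ws _ _)); last lra.
    exact: lt_le_trans sw wxm.
  (* A point of []y, m[] within [e] of [m]. *)
  pose z := Num.max ((y + m) / 2) (m - e / 2).
  have zm : z < m by rewrite /z gt_max; apply/andP; split; lra.
  have zy : y < z by rewrite /z lt_max; apply/orP; left; lra.
  have ze : m - e < z by rewrite /z lt_max; apply/orP; right; lra.
  have := He z; rewrite ze zm => /(_ isT); apply/negP; rewrite -leNgt.
  by apply: mmax; move: myx; rewrite !in_itv/=; lra.
(* Far enough back that a slope of at most [- c] forces a drop of [2 * |B| + 1], more than the
   oscillation of [w] allows. The absolute value saves proving [0 <= B]. *)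
pose y := x0 - (2 * `|B| + 1) / c.
have yx : y < x0.
  by rewrite /y ltrBlDr ltrDl divr_gt0//; have := normr_ge0 B; lra.
have [z zyx E] : exists2 z, z \in `]y, x0[ & w x0 - w y = derive1 w z * (x0 - y).
  apply: MVT => // z _; apply: DeriveDef => //; by rewrite derive1E.
have dz : derive1 w z <= - c.
  apply: ws; apply: lt_le_trans sw _; apply: back.
  by move: zyx; rewrite in_itv/=; lra.
have E2 : c * (x0 - y) = 2 * `|B| + 1.
  by rewrite /y opprD opprK addrA subrr add0r mulrC divfK// gt_eqF.
have : w x0 - w y <= - (2 * `|B| + 1) by rewrite E -E2; nra.
have := wB x0; have := wB y; have := ler_norm B.
by rewrite !ler_norml; lra.
Qed.

Lemma is_derive_derive1 (R : realType) (f : R -> R) (x : R) :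
  derivable f x 1 -> is_derive x 1 f (derive1 f x).
Proof. by move=> df; apply: DeriveDef; rewrite // derive1E. Qed.

(** Compactness of the square: the local constants around its pairs of points are merged into
    one. *)
Lemma locally_lipschitz_segment (R : realType) (f : R -> R) (a b : R) :
  locally_lipschitz_on setT f ->
  exists2 L, 0 < L &
    {in `[a, b] &, forall x y, `|f x - f y| <= L * `|x - y|}.
Proof.
move=> flip.
have cab : compact (`[a, b] `*` `[a, b] : set (R * R)).
  by apply: compact_setX; exact: segment_compact.
have /(_ R (pinfty_nbhs R)
    (fun M z => `|f z.1 - f z.2| <= M * `|z.1 - z.2|)) :=
  (compact_near_coveringP _).1 cab.
case=> [[z1 z2] _|M [_ HM]].
  have [M [_ HM]] : \forall M \near +oo, \forall z \near (z1, z2),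
      `|f z.1 - f z.2| <= M * `|z.1 - z.2|.
    have := flip (z1, z2); rewrite /= setXTT => /(_ (conj I I)).
    move=> [M [Mr HM]]; exists M; split=> // N /HM.
    by move=> h; apply: (@filterS _ _ (nbhs_filter (z1, z2))) h => z; exact.
  (* A Lipschitz inequality survives enlarging the constant, so the neighbourhood found for [M + 1]
     serves every larger [N]. *)
  exists ([set z | `|f z.1 - f z.2| <= (M + 1) * `|z.1 - z.2|], [set N | M + 1 < N]).
    split => /=; first by apply: HM; rewrite ltrDl.
    by exists (M + 1); split; rewrite ?num_real.
  move=> [z N] /= [h MN]; apply: (le_trans h).
  by rewrite ler_wpM2r// ltW.
exists (Num.max 1 (M + 1)); first by rewrite lt_max ltr01.
move=> x y xab yab; apply: (HM _ _ (x, y)) => //.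
by rewrite lt_max ltrDl ltr01 orbT.
Qed.

Lemma lipschitz_segments_locally (R : realType) (A : set R) (f : R -> R) :
  (forall a b, exists L, forall x y, A x -> A y ->
     x \in `[a, b] -> y \in `[a, b] -> `|f x - f y| <= L * `|x - y|) ->
  locally_lipschitz_on A f.
Proof.
move=> H [z1 z2] [/= Az1 Az2].
(* This segment contains the unit balls around both points. *)
have [L HL] := H (Num.min z1 z2 - 1) (Num.max z1 z2 + 1).
exists L; split; first exact: num_real.
move=> M LM; rewrite /dominated_by /= /within /=.
exists (ball z1 (1 : R), ball z2 (1 : R)).
  by split; exact: nbhsx_ballx.
move=> [x y] /= [xz yz] [Ax Ay].
apply: le_trans (HL _ _ Ax Ay _ _) _; last by rewrite ler_wpM2r// ltW.
- move: xz; rewrite /ball/= ltr_norml in_itv/=.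
  have : Num.min z1 z2 <= z1 by rewrite ge_min lexx.
  have : z1 <= Num.max z1 z2 by rewrite le_max lexx.
  lra.
- move: yz; rewrite /ball/= ltr_norml in_itv/=.
  have : Num.min z1 z2 <= z2 by rewrite ge_min lexx orbT.
  have : z2 <= Num.max z1 z2 by rewrite le_max lexx orbT.
  lra.
Qed.

Lemma locally_lipschitz_continuous (R : realType) (f : R -> R) :
  locally_lipschitz_on setT f -> continuous f.
Proof.
move=> flip x; have [L L0 HL] := locally_lipschitz_segment (x - 1) (x + 1) flip.
apply/cvgrPdist_le => e e0.
near=> y.
have xy : `|x - y| < Num.min 1 (e / L).
  near: y; apply: cvgr_dist_lt; last by rewrite lt_min ltr01 divr_gt0.
  exact: cvg_id.
move: xy; rewrite lt_min => /andP[xy1 xyL].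
apply: (le_trans (HL _ _ _ _)); last by rewrite mulrC -ler_pdivlMr// ltW.
- by rewrite in_itv/=; lra.
- by move: xy1; rewrite in_itv/= ltr_norml; lra.
Unshelve. all: by end_near. Qed.

(** Strict monotonicity made uniform: [c] is the minimum over [[0, K]] of the positive continuous
    function [f (p + e) - f p]. *)
Lemma increasing_gap (R : realType) (f : R -> R) (K e : R) :
  continuous f -> {in `[0, +oo[ &, {homo f : p q / p < q}} -> 0 < e ->
  exists2 c, 0 < c & forall p q, 0 <= p -> p <= K -> p + e <= q -> f p + c <= f q.
Proof.
move=> cf incr e0; have [K0|K0] := leP 0 K; last first.
  by exists 1 => // p q p0 pK; lra.
have [|m mK min] := @EVT_min R (fun p => f (p + e) - f p) 0 K K0.
  apply: continuous_subspaceT => x; apply: cvgB; last exact: cf.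
  by apply: continuous_comp; [apply: cvgD; [exact: cvg_id|exact: cvg_cst]|exact: cf].
have m0 : 0 <= m by move: mK; rewrite in_itv/= => /andP[].
exists (f (m + e) - f m).
  by rewrite subr_gt0; apply: incr; rewrite ?in_itv/= ?andbT; lra.
move=> p q p0 pK pq.
have : f (p + e) <= f q.
  move: pq; rewrite le_eqVlt => /predU1P[->//|pq]; apply/ltW/incr => //;
  by rewrite in_itv/= andbT; lra.
have := min p; rewrite in_itv/= p0 pK => /(_ isT); lra.
Qed.

(** * Comparison of slopes *)

(** First-order equation for [u = F']; [W] stands for [beta * V]. *)
Definition slope_eq (R : realType) (G a W : R -> R) (lam : R) (u : R -> R) :=
  forall x, derivable u x 1 /\ a x * derive1 u x + G (u x) + W x = lam.

Lemma slope_eq_derive1 (R : realType) (G a W : R -> R) (lam : R) (u : R -> R) x :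
  0 < a x -> slope_eq G a W lam u ->
  derive1 u x = (lam - W x - G (u x)) / a x.
Proof. by move=> ax /(_ x)[_ <-]; field; rewrite gt_eqF. Qed.

Lemma slope_eq_continuous (R : realType) (G a W : R -> R) (lam : R) (u : R -> R) :
  slope_eq G a W lam u -> continuous u.
Proof.
by move=> eu x; apply/differentiable_continuous/derivable1_diffP; case: (eu x).
Qed.

Lemma slope_eq_continuous_derive1 (R : realType) (G a W : R -> R) (lam : R)
    (u : R -> R) :
  continuous G -> continuous a -> continuous W -> (forall x, 0 < a x) ->
  slope_eq G a W lam u -> continuous (derive1 u).
Proof.
move=> cG ca cW a0 eu.
have -> : derive1 u = (fun x => (lam - W x - G (u x)) * (a x)^-1).
  by apply/funext => x; rewrite (slope_eq_derive1 (a0 x) eu).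
move=> x; apply: cvgM; last by apply: cvgV; [rewrite gt_eqF|exact: ca].
apply: cvgB; first by apply: cvgB; [exact: cvg_cst|exact: cW].
by apply: continuous_comp; [exact: slope_eq_continuous eu x|exact: cG].
Qed.

Section compare_slopes.
Context {R : realType} {G a W : R -> R} {K : R}.
Context {lam1 lam2 : R} {u1 u2 : R -> R}.
Hypothesis a_bound : forall x, 0 < a x <= 1.
Hypothesis eu1 : slope_eq G a W lam1 u1.
Hypothesis eu2 : slope_eq G a W lam2 u2.
Hypothesis u1K : forall x, 0 <= u1 x <= K.
Hypothesis u2K : forall x, 0 <= u2 x <= K.

Let derive1_diff x :
  derivable (u2 - u1) x 1 /\
  a x * derive1 (u2 - u1) x = lam2 - lam1 - (G (u2 x) - G (u1 x)).
Proof.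
have [d1 e1] := eu1 x; have [d2 e2] := eu2 x; split; first exact: derivableB.
by rewrite derive1E deriveB// -!derive1E -e1 -e2; ring.
Qed.

Let diff_bound x : `|(u2 - u1) x| <= K.
Proof.
have := u1K x; have := u2K x.
by rewrite (_ : (u2 - u1) x = u2 x - u1 x)// ler_norml; lra.
Qed.

(** Where [u2 - u1] exceeds [d], the gap in [G] outweighs [lam2 - lam1], so the difference decreases
    at rate at least [c - (lam2 - lam1)]; dividing by [a <= 1] only strengthens this. A bounded
    function on the whole line cannot do so. *)
Lemma slope_eq_le (d c : R) :
  (forall p q, 0 <= p -> p <= K -> p + d <= q -> G p + c <= G q) ->
  lam2 - lam1 < c -> forall x, u2 x <= u1 x + d.
Proof.
move=> gap lamc x; rewrite -lerBlDl.
apply: (@le_of_derive1_le _ (u2 - u1) K (c - (lam2 - lam1)) d) => //.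
- by move=> y; case: (derive1_diff y).
- by rewrite subr_gt0.
move=> y; rewrite (_ : (u2 - u1) y = u2 y - u1 y)// => dy.
have [_ E] := derive1_diff y; have := u1K y => /andP[u0 uK].
have := gap (u1 y) (u2 y) u0 uK; have := a_bound y; nra.
Qed.

(** Where [u2 - u1] is below the threshold, the Lipschitz bound lets [G] absorb at most half of
    [lam2 - lam1]; the other half makes [u2 - u1] increase, which is excluded as before, now for
    [u1 - u2]. *)
Lemma slope_eq_ge (L : R) :
  0 < L -> {in `[0, K] &, forall p q, `|G p - G q| <= L * `|p - q|} ->
  {in `[0, +oo[ &, {homo G : p q / p < q}} ->
  lam1 < lam2 -> forall x, u1 x + (lam2 - lam1) / (2 * L) <= u2 x.
Proof.
move=> L0 GL incr lam12 x.
suff : forall x, - (u2 - u1) x <= - ((lam2 - lam1) / (2 * L)).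
  by move=> /(_ x); rewrite (_ : (u2 - u1) x = u2 x - u1 x)//; lra.
apply: (@le_of_derive1_le _ (- (u2 - u1)) K ((lam2 - lam1) / 2)).
- by move=> y; apply: derivableN; case: (derive1_diff y).
- by move=> y; rewrite (_ : (- (u2 - u1)) y = - (u2 - u1) y)// normrN.
- by rewrite divr_gt0 ?subr_gt0.
move=> y; rewrite (_ : (- (u2 - u1)) y = - (u2 y - u1 y))// ltrN2 => dy.
have [dd E] := derive1_diff y.
rewrite derive1E deriveN// -derive1E lerN2.
have G12 : G (u2 y) - G (u1 y) <= (lam2 - lam1) / 2.
  have /andP[u10 u1K'] := u1K y; have /andP[u20 u2K'] := u2K y.
  (* The Lipschitz bound matters only when [u1 y < u2 y]; otherwise the increment of [G] is at most
     zero. *)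
  have [u12|u21|->] := ltgtP (u1 y) (u2 y); last by rewrite subrr; lra.
    apply: le_trans (ler_norm _) _; apply: le_trans (GL _ _ _ _) _;
      rewrite ?in_itv/= ?u10 ?u20//.
    rewrite gtr0_norm ?subr_gt0//.
    have -> : (lam2 - lam1) / 2 = L * ((lam2 - lam1) / (2 * L)).
      by field; rewrite gt_eqF.
    by rewrite ler_pM2l// ltW.
  by have := incr _ _ _ _ u21; rewrite !in_itv/= u10 u20 => /(_ isT isT); lra.
have := a_bound y; nra.
Qed.

End compare_slopes.

Lemma slope_eq_unique (R : realType) (G a W : R -> R) (K lam : R) (u v : R -> R) :
  continuous G -> {in `[0, +oo[ &, {homo G : p q / p < q}} ->
  (forall x, 0 < a x <= 1) ->
  slope_eq G a W lam u -> slope_eq G a W lam v ->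
  (forall x, 0 <= u x <= K) -> (forall x, 0 <= v x <= K) -> u = v.
Proof.
move=> cG incr ab; suff le w z : slope_eq G a W lam w -> slope_eq G a W lam z ->
  (forall x, 0 <= w x <= K) -> (forall x, 0 <= z x <= K) -> forall x, z x <= w x.
  by move=> eu ev uK vK; apply/funext => x; apply/le_anti; rewrite !le.
move=> ew ez wK zK x; apply/ler_addgt0Pr => e e0.
have [c c0 gap] := increasing_gap K cG incr e0.
by apply: (slope_eq_le ab ew ez wK zK gap); rewrite subrr.
Qed.

(** Uniform continuity with only [x] confined to the segment, so that the expansion at [x + h] below
    may leave it. *)
Lemma continuous_segment_uniform (R : realType) (f : R -> R) (a b e : R) :
  continuous f -> 0 < e -> exists2 d, 0 < d &
    forall x y, a <= x <= b -> `|x - y| < d -> `|f x - f y| <= e.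
Proof.
move=> cf e0.
have /(_ R 0^'+ (fun d x => forall y, `|x - y| < d -> `|f x - f y| <= e)) :=
  (compact_near_coveringP _).1 (@segment_compact R a b).
case=> [x _|d /= d0 Hd].
  have e20 : 0 < e / 2 by lra.
  have /cvgrPdist_le/(_ _ e20)[r /= r0 Hr] := cf x.
  exists (ball x (r / 2), [set d | d < r / 2]).
    split=> /=; first by apply: nbhsx_ballx; lra.
    by apply: nbhs_right_lt; lra.
  move=> [z d]/= [xz dr] y zy.
  have h1 : `|f x - f z| <= e / 2 by apply: Hr; rewrite /= (lt_trans xz)//; lra.
  have h2 : `|f x - f y| <= e / 2.
    apply: Hr => /=; rewrite (_ : x - y = (x - z) + (z - y)); last by ring.
    apply: (le_lt_trans (ler_normD _ _)); rewrite /ball/= in xz; lra.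
  rewrite (_ : f z - f y = (f x - f y) - (f x - f z)); last by ring.
  by apply: (le_trans (ler_normB _ _)); lra.
exists (d / 2); first by rewrite /= in d0; lra.
move=> x y xab; apply: (Hd (d / 2)) => //=; rewrite /= in d0; last by lra.
by rewrite sub0r normrN gtr0_norm; lra.
Qed.

(** Mean value theorem plus uniform continuity of the derivative; this is the consistency of the
    Euler scheme. *)
Lemma uniform_taylor1 (R : realType) (u : R -> R) (a b e : R) :
  (forall x, derivable u x 1) -> continuous (derive1 u) -> 0 < e ->
  exists2 d, 0 < d & forall x h, a <= x <= b -> 0 < h < d ->
    `|u (x + h) - u x - h * derive1 u x| <= h * e.
Proof.
move=> du cdu e0; have [d d0 Hd] := continuous_segment_uniform a b cdu e0.
exists d => // x h xab /andP[h0 hd].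
have xh : x < x + h by rewrite ltrDl.
have [z zx ->] : exists2 z, z \in `]x, (x + h)[ &
    u (x + h) - u x = derive1 u z * ((x + h) - x).
  apply: MVT xh _ _ => [z _|]; first exact: is_derive_derive1.
  by apply: derivable_within_continuous => z _.
rewrite (_ : _ - _ = h * (derive1 u z - derive1 u x)); last by ring.
rewrite normrM gtr0_norm// ler_pM2l// distrC; apply: Hd => //.
by move: zx; rewrite in_itv/= => zx; rewrite distrC gtr0_norm; lra.
Qed.

(** * Explicit Euler schemes *)

(** Projection onto [[0, K]], the range on which the Lipschitz constant of [G] is available. *)
Definition clip (R : realType) (K y : R) : R := Num.max 0 (Num.min K y).

Lemma clip_itv (R : realType) (K y : R) : 0 <= K -> 0 <= clip K y <= K.
Proof. by move=> K0; rewrite /clip le_max lexx/= ge_max K0 ge_min lexx. Qed.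

Lemma clip_dist (R : realType) (K y v : R) :
  0 <= v <= K -> `|clip K y - v| <= `|y - v|.
Proof.
move=> /andP[v0 vK]; rewrite /clip /Num.max /Num.min.
by case: (ltP K y) => ?; case: ifP => ?;
  rewrite ?ler_norml ?[X in X <= _]ler0_norm; case: (ler0P (y - v)); lra.
Qed.

(** Explicit scheme for [u' = (lam - W - G u) / a] started from the value 0 at [x0]. It reads [a]
    and [W] at finitely many points only, whence its measurability in the environment. *)
Fixpoint euler (R : realType) (G a W : R -> R) (lam K x0 h : R) (k : nat) : R :=
  if k is j.+1 then
    let x := x0 + j%:R * h in
    let y := euler G a W lam K x0 h j in
    clip K (y + h / a x * (lam - W x - G y))
  else 0.

Lemma euler_itv (R : realType) (G a W : R -> R) (lam K x0 h : R) (k : nat) :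
  0 <= K -> 0 <= euler G a W lam K x0 h k <= K.
Proof. by move=> K0; case: k => [|k]; [rewrite lexx K0|exact: clip_itv]. Qed.

(* The Lipschitz condition [h * L <= ax] makes the explicit step a contraction,
   and [G] being increasing makes it strictly so. *)
Lemma euler_step_dist (R : realType) (G : R -> R) (K L h ax w e y v v' : R) :
  {in `[0, K] &, forall p q, `|G p - G q| <= L * `|p - q|} ->
  {in `[0, +oo[ &, {homo G : p q / p < q}} ->
  0 < ax <= 1 -> 0 < h -> h * L <= ax ->
  0 <= y <= K -> 0 <= v <= K -> 0 <= v' <= K ->
  `|v' - v - h * ((w - G v) / ax)| <= h * e ->
  `|clip K (y + h / ax * (w - G y)) - v'| <=
    `|y - v| - h * `|G y - G v| + h * e.
Proof.
move=> GL incr /andP[a0 a1] h0 hL yK vK v'K cons.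
apply: le_trans (clip_dist _ v'K) _.
(* The error splits into the difference of two Euler steps, from [y] and from [v], and the
   consistency error of [v']. *)
rewrite (_ : _ - v' = (y - v - h / ax * (G y - G v)) -
    (v' - v - h * ((w - G v) / ax))); last by field; rewrite gt_eqF.
apply: le_trans (ler_normB _ _) _; apply: lerD => //.
have ha : h <= h / ax by rewrite ler_pdivlMr// ler_piMr// ltW.
have haL : h / ax * L <= 1 by rewrite mulrAC ler_pdivrMr// mul1r.
wlog yv : y v yK vK {cons v'K} / v < y.
  move=> H; have [/H|/H|->] := ltgtP v y; first exact.
  - move=> /(_ vK yK); rewrite [`|v - y|]distrC [`|G v - G y|]distrC.
    by rewrite -[X in `|X| <= _ -> _]opprK normrN (_ : - (_ - _) = y - v - h / ax * (G y - G v)) //; ring.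
  - by rewrite !subrr mulr0 subrr normr0 mulr0 subrr.
have Gyv : G v < G y.
  by apply: incr => //; rewrite in_itv/= andbT; case/andP: yK; case/andP: vK.
have := GL y v; rewrite !in_itv/= => /(_ yK vK).
rewrite (@gtr0_norm _ (y - v)) ?subr_gt0// (@gtr0_norm _ (G y - G v)) ?subr_gt0// => Glip.
rewrite ger0_norm; first by apply: lerB => //; rewrite ler_wpM2r// ltW// subr_gt0.
rewrite subr_ge0; apply: (@le_trans _ _ (h / ax * (L * (y - v)))).
  by rewrite ler_wpM2l// ltW// divr_gt0.
by rewrite mulrA ler_piMl// ltW// subr_gt0.
Qed.

(** The initial error is at most [K]. While it is at least [d], each step reduces it by
    [h * (c - e)]; below [d], a step adds at most [h * e]. The maximum records these two regimes. *)
Lemma euler_dist (R : realType) (G a W : R -> R) (lam K L x0 h e c d : R)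
    (u : R -> R) (n : nat) :
  {in `[0, K] &, forall p q, `|G p - G q| <= L * `|p - q|} ->
  {in `[0, +oo[ &, {homo G : p q / p < q}} ->
  (forall p q, 0 <= p -> p <= K -> p + d <= q -> G p + c <= G q) ->
  slope_eq G a W lam u -> (forall x, 0 <= u x <= K) ->
  (forall x, 0 < a x <= 1) -> 0 < h -> e <= c ->
  (forall k, (k < n)%N -> let x := x0 + k%:R * h in
     h * L <= a x /\ `|u (x + h) - u x - h * derive1 u x| <= h * e) ->
  forall k, (k <= n)%N ->
  `|euler G a W lam K x0 h k - u (x0 + k%:R * h)| <=
    Num.max (d + h * e) (K - k%:R * (h * (c - e))).
Proof.
move=> GL incr gap eu uK ab h0 ec Hx.
have K0 : 0 <= K by have /andP[] := uK 0; exact: le_trans.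
elim=> [_|k IHk kn].
  have /andP[u0 u1] := uK (x0 + 0%:R * h).
  by rewrite le_max !mul0r subr0 addr0 sub0r normrN in u0 u1 *; rewrite ger0_norm// u1 orbT.
rewrite /=; set x := x0 + k%:R * h in IHk *; set y := euler _ _ _ _ _ _ _ k in IHk *.
have -> : x0 + k.+1%:R * h = x + h by rewrite /x -natr1; ring.
have [hL cons] := Hx _ kn.
have ax0 : 0 < a x by case/andP: (ab x).
have yK : 0 <= y <= K by exact: euler_itv.
rewrite (slope_eq_derive1 ax0 eu) in cons.
have step := euler_step_dist GL incr (ab x) h0 hL yK (uK x) (uK (x + h)) cons.
apply: (le_trans step).
have hG : 0 <= h * `|G y - G (u x)| by rewrite mulr_ge0// ltW.
have [yd|yd] := ltP `|y - u x| d; first by rewrite le_max; apply/orP; left; lra.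
have hc : c <= `|G y - G (u x)|.
  have /andP[y0 y1] := yK; have /andP[u0 u1] := uK x.
  have [uy|yu] := leP (u x) y.
    have := gap (u x) y u0 u1; rewrite ger0_norm ?subr_ge0// in yd.
    by move=> g; apply: le_trans (ler_norm _); have := g ltac:(lra); lra.
  have := gap y (u x) y0 y1; rewrite ltr0_norm ?subr_lt0// in yd.
  by move=> g; rewrite distrC; apply: le_trans (ler_norm _); have := g ltac:(lra); lra.
have {}IHk := IHk (ltnW kn).
have hcG : h * c <= h * `|G y - G (u x)| by rewrite ler_pM2l.
move: IHk; rewrite !le_max => /orP[IH|IH].
  (* From the first regime with error at least [d]: the contraction [h * c] compensates the
     consistency error [h * e]. *)
  apply/orP; left; have : h * e <= h * c by rewrite ler_pM2l.
  lra.
apply/orP; right; rewrite -natr1; lra.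
Qed.

(** For a fixed starting time the Euler values are only shown to end up near the slope, not to
    converge, so a limit superior is taken in the step size. *)
Lemma limn_esup_bounds (R : realType) (v : nat -> \bar R) (l r : \bar R) (M : nat) :
  (forall m, (M <= m)%N -> (l <= v m <= r)%E) -> (l <= limn_esup v <= r)%E.
Proof.
move=> H; rewrite limn_esup_lim; apply/andP; split.
  apply: lime_ge; first exact: is_cvg_esups.
  exists M => // m /= Mm; have /andP[lv _] := H m Mm; apply: (le_trans lv).
  by apply: ereal_sup_ubound; exists m => /=.
apply: lime_le; first exact: is_cvg_esups.
exists M => // m /= Mm; apply: ge_ereal_sup => _ [k /= mk <-].
by have /andP[] := H k (leq_trans Mm mk).
Qed.

(** The time [n] needed to forget the initial value depends on [G], [K] and [d] alone; how small the
    step must be depends also on the environment, through the minimum of [a] and the modulus of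
    continuity of [u']. *)
Lemma euler_cvg (R : realType) (G : R -> R) (K d : R) :
  locally_lipschitz_on setT G -> {in `[0, +oo[ &, {homo G : p q / p < q}} ->
  0 <= K -> 0 < d ->
  exists N, forall (a W u : R -> R) (lam : R), continuous a -> continuous W ->
    (forall x, 0 < a x <= 1) -> slope_eq G a W lam u ->
    (forall x, 0 <= u x <= K) -> forall n, (N <= n)%N -> exists M, forall m,
      (M <= m)%N ->
      `|euler G a W lam K (- n%:R) m.+1%:R^-1 (n * m.+1) - u 0| <= d.
Proof.
move=> Glip incr K0 d0; have cG := locally_lipschitz_continuous Glip.
have [L L0 GL] := locally_lipschitz_segment 0 K Glip.
have d20 : 0 < d / 2 by lra.
have [c c0 gap] := increasing_gap K cG incr d20.
(* The bound [c / 2] keeps a contraction rate [c - e >= c / 2]; the bound [d / 2] keeps the final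
   error [d / 2 + h * e] below [d]. *)
pose e := Num.min (c / 2) (d / 2).
have e0 : 0 < e by rewrite /e lt_min; apply/andP; split; lra.
have ec : e <= c / 2 by rewrite /e ge_min lexx.
have ed : e <= d / 2 by rewrite /e ge_min lexx orbT.
exists (Num.bound (K / (c / 2))) => a W u lam ca cW ab eu uK n Nn.
have nK : K <= n%:R * (c - e).
  have Kc : K / (c / 2) < n%:R.
    have Kc0 : 0 <= K / (c / 2) by rewrite divr_ge0//; lra.
    by apply: lt_le_trans (archi_boundP Kc0) _; rewrite ler_nat.
  apply: (@le_trans _ _ (n%:R * (c / 2))).
    by rewrite -ler_pdivrMr ?ltW//; lra.
  by rewrite ler_wpM2l//; lra.
have a0 x : 0 < a x by case/andP: (ab x).
have n0 : - n%:R <= 0 :> R by rewrite oppr_le0.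
have [x1 x1n amin] := @EVT_min R a _ _ n0 (continuous_subspaceT ca).
have [r r0 Hr] := uniform_taylor1 (- n%:R) 0 (fun x => (eu x).1)
  (slope_eq_continuous_derive1 cG ca cW a0 eu) e0.
(* The step must be below [r] for consistency and below [a x1 / L], with [a x1] the minimum of [a]
   on [[-n, 0]], for stability. *)
have rr0 : 0 < Num.min r (a x1 / L) by rewrite lt_min r0 divr_gt0.
have [M _ HM] := near_infty_natSinv_lt (PosNum rr0).
exists M => m Mm; set h := m.+1%:R^-1.
have := HM m Mm; rewrite /= lt_min -/h => /andP[hr hL].
have h0 : 0 < h by rewrite /h invr_gt0.
have h1 : h <= 1 by rewrite /h invf_le1// ler1n.
have hm : m.+1%:R * h = 1 by rewrite /h divff// gt_eqF.
have step k : (k < n * m.+1)%N -> let x := - n%:R + k%:R * h in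
    h * L <= a x /\ `|u (x + h) - u x - h * derive1 u x| <= h * e.
  move=> kn /=; set x := - n%:R + k%:R * h.
  have x0 : - n%:R <= x <= 0.
    rewrite /x lerDl mulr_ge0 ?(ltW h0)//= addrC subr_le0.
    have -> : n%:R = (n * m.+1)%:R * h by rewrite natrM -mulrA hm mulr1.
    by rewrite ler_wpM2r ?(ltW h0)// ler_nat ltnW.
  split; last by apply: Hr => //; rewrite h0 hr.
  apply: (@le_trans _ _ (a x1)); last exact: amin.
  by rewrite -ler_pdivlMr// ltW.
(* After [n * m.+1] steps of length [1 / m.+1] from [-n], the grid has reached 0. *)
have := euler_dist GL incr gap eu uK ab h0 _ step (leqnn _).
rewrite natrM -mulrA hm mulr1 addNr => /(_ ltac:(lra)) /le_trans; apply.
rewrite ge_max -mulrA [m.+1%:R * _]mulrA hm mul1r; apply/andP; split; last lra.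
by have : h * e <= e; [rewrite ler_piMl// ltW|lra].
Qed.

Lemma measurable_euler (R : realType) (d : measure_display) (T : measurableType d)
    (G : R -> R) (a W : R -> T -> R) (lam K x0 h : R) (k : nat) :
  continuous G -> (forall x, measurable_fun setT (a x)) ->
  (forall x, measurable_fun setT (W x)) -> (forall x w, 0 < a x w) ->
  measurable_fun setT
    (fun w => euler G (fun x => a x w) (fun x => W x w) lam K x0 h k).
Proof.
move=> cG ma mW a0; elim: k => [|k IHk] /=; first exact: measurable_cst.
apply: measurable_maxr; first exact: measurable_cst.
apply: measurable_minr; first exact: measurable_cst.
apply: measurable_funD => //.
apply: measurable_funM; last first.
  apply: measurable_funB; first by apply: measurable_funB.
  by apply: measurableT_comp IHk; exact: continuous_measurable_fun.
apply: measurable_funM; first exact: measurable_cst.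
(* The inverse of the positive [a] is written as a real power, which is known to be measurable. *)
rewrite (_ : (fun w => _) = (fun w => a (x0 + k%:R * h) w `^ (-1))).
  exact: (measurableT_comp (measurable_powR (-1)) (ma _)).
by apply/funext => w; rewrite powR_inv1// ltW.
Qed.

Lemma measurable_slope (R : realType) (d : measure_display) (T : measurableType d)
    (G : R -> R) (a W u : R -> T -> R) (lam K : R) :
  locally_lipschitz_on setT G -> {in `[0, +oo[ &, {homo G : p q / p < q}} ->
  (forall x, measurable_fun setT (a x)) -> (forall x, measurable_fun setT (W x)) ->
  (forall w, continuous (a ^~ w)) -> (forall w, continuous (W ^~ w)) ->
  (forall x w, 0 < a x w <= 1) ->
  (forall w, slope_eq G (a ^~ w) (W ^~ w) lam (u ^~ w)) ->
  (forall x w, 0 <= u x w <= K) -> measurable_fun setT (u 0).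
Proof.
move=> Glip incr ma mW ca cW ab eu uK.
have cG := locally_lipschitz_continuous Glip.
apply/measurable_EFinP.
pose y n m w :=
  euler G (a ^~ w) (W ^~ w) lam K (- n%:R) m.+1%:R^-1 (n * m.+1).
(* Iterated limit: first the step size tends to 0 with the starting time [-n] fixed, then [n] tends
   to infinity. *)
apply: (emeasurable_fun_cvg (fun n w => limn_esup (fun m => (y n m w)%:E))).
  move=> n; apply: measurable_fun_limn_esup => m; apply/measurable_EFinP.
  by apply: measurable_euler => // x w; case/andP: (ab x w).
move=> w _.
have K0 : 0 <= K by have /andP[] := uK 0 w; exact: le_trans.
have near_u (e : R) : 0 < e -> exists N, forall n, (N <= n)%N ->
    ((u 0 w - e)%:E <= limn_esup (fun m => (y n m w)%:E) <= (u 0 w + e)%:E)%E.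
  move=> e0; have [N HN] := euler_cvg Glip incr K0 e0.
  exists N => n Nn.
  have [M HM] := HN _ _ _ _ (ca w) (cW w) (ab ^~ w) (eu w) (uK ^~ w) n Nn.
  apply: (@limn_esup_bounds _ _ _ _ M) => m /HM.
  by rewrite !lee_fin -/(y n m w) ler_distlC => /andP[]; lra.
apply/fine_cvgP; split.
  have [N HN] := near_u 1 ltr01; exists N => // n /= /HN.
  by case: limn_esup => //= /andP[].
apply/cvgrPdist_le => e e0; have [N HN] := near_u e e0; exists N => // n /= /HN.
case: limn_esup => [r|/andP[_ /=]|/andP[/=]] //.
by rewrite /= !lee_fin ler_distlC; lra.
Qed.

(** * Inverses of effectively increasing functions *)

Lemma inv_on_spec (R : realType) (A : set R) (f : R -> R) (y : R) :
  (f @` A) y -> A (inv_on A f y) /\ f (inv_on A f y) = y.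
Proof.
move=> Ay; split; last by apply: pinvK; rewrite inE.
by apply: (@surjpinv_image_sub _ _ (fun=> 0) A (f @` A) f) => //; exists y.
Qed.

Lemma surj_nonneg (R : realType) (G : R -> R) (l : R) :
  continuous G -> G p @[p --> +oo] --> +oo -> G 0 = 0 -> 0 <= l ->
  (G @` `[0, +oo[) l.
Proof.
move=> cG Gy G0 l0; have /cvgryPge/(_ l)[p0 [_ Hp]] := Gy.
pose p := Num.max 1 (p0 + 1).
have lp : l <= G p by apply: Hp; rewrite lt_max ltrDl ltr01 orbT.
have p0' : 0 <= p by rewrite le_max ler01.
have [||q] := @IVT R G 0 p l p0'; first exact: continuous_subspaceT.
  by rewrite G0 ge_min l0 le_max lp orbT.
by rewrite in_itv/= => /andP[q0 _] <-; exists q => //=; rewrite in_itv/= q0.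
Qed.

Section effective.
Context {R : realType} {theta : R -> R} {b : R}.
Hypothesis theta_ge : forall K, exists2 L, 0 < L & forall l1 l2,
  b <= l1 -> l1 < l2 -> l2 <= K -> l2 - l1 <= L * (theta l2 - theta l1).
Hypothesis theta_le : forall K e : R, 0 < e -> exists2 c, 0 < c & forall l1 l2,
  b <= l1 <= K -> b <= l2 <= K -> l2 - l1 < c -> theta l2 <= theta l1 + e.
Hypothesis theta_unbounded : forall M, exists2 l, b <= l & M <= theta l.

Lemma effective_lt : {in `[b, +oo[ &, {homo theta : x y / x < y}}.
Proof.
move=> x y; rewrite !in_itv/= !andbT => bx _ xy.
have [L L0 /(_ x y bx xy (lexx _))] := theta_ge y; rewrite -subr_gt0.
by move=> H; rewrite -(pmulr_rgt0 _ L0); lra.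
Qed.

Lemma effective_inj : {in `[b, +oo[ &, injective theta}.
Proof.
move=> x y bx yb xy; apply/eqP; case: ltgtP => // [/effective_lt|/effective_lt];
  by rewrite xy ltxx => /(_ _ _)->.
Qed.

Let theta_dist K e : 0 < e -> exists2 c, 0 < c & forall l1 l2,
  b <= l1 <= K -> b <= l2 <= K -> `|l1 - l2| < c -> `|theta l1 - theta l2| <= e.
Proof.
move=> e0; have [c c0 H] := theta_le K e0; exists c => // l1 l2 l1K l2K.
rewrite ltr_norml ler_distl => l12.
by have := H _ _ l1K l2K ltac:(lra); have := H _ _ l2K l1K ltac:(lra); lra.
Qed.

Lemma effective_continuous : {within `[b, +oo[, continuous theta}.
Proof.
apply/continuous_within_itvcyP; split=> [x|].
  rewrite in_itv/= andbT => bx; apply/cvgrPdist_le => e e0.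
  have [c c0 H] := theta_dist (x + 1) e0.
  (* Distance below [x - b] keeps [y] in the domain, and distance below 1 keeps it under the bound
     [x + 1] for which [c] was chosen. *)
  near=> y; have xy : `|x - y| < Num.min (Num.min c 1) (x - b).
    near: y; apply: cvgr_dist_lt; last by rewrite !lt_min c0 ltr01 subr_gt0.
    exact: cvg_id.
  move: xy; rewrite !lt_min => /andP[/andP[xy1 xy2] xy3].
  by apply: H => //; move: xy2 xy3; rewrite ?ltr_norml; lra.
apply/cvgrPdist_le => e e0; have [c c0 H] := theta_dist (b + 1) e0.
near=> y; have by' : b < y by near: y; exact: nbhs_right_gt.
have yb : y < b + Num.min c 1.
  by near: y; apply: nbhs_right_lt; rewrite ltrDl lt_min c0 ltr01.
have /andP[yc y1] : (y < b + c) && (y < b + 1) by rewrite -lt_min -addr_minr.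
by apply: H; rewrite ?ltr0_norm; lra.
Unshelve. all: by end_near. Qed.

Lemma effective_surj y : theta b <= y -> (theta @` `[b, +oo[) y.
Proof.
move=> yb; have [l bl yl] := theta_unbounded y.
have [||q] := @IVT R theta b l y bl.
- apply: continuous_subspaceW effective_continuous => x /=.
  by rewrite !in_itv/= => /andP[->].
- by rewrite ge_min yb le_max yl orbT.
by rewrite in_itv/= => /andP[q0 _] <-; exists q => //=; rewrite in_itv/= q0.
Qed.

Lemma effective_bij : set_bij `[b, +oo[ `[theta b, +oo[ theta.
Proof.
split=> [x /=|x y|x /=].
- rewrite !in_itv/= !andbT le_eqVlt => /predU1P[->//|bx].
  by apply/ltW/effective_lt => //; rewrite in_itv/= ?lexx ?ltW.
- by rewrite !inE; exact: effective_inj.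
- by rewrite in_itv/= andbT => /effective_surj.
Qed.

(** Once [theta K >= d], monotonicity puts every preimage of a point of [[c, d]] below [K], and
    [theta_ge] for this [K] is the Lipschitz bound. *)
Lemma effective_inv_lipschitz (c d : R) : exists L, forall x y,
  theta b <= x -> theta b <= y -> x \in `[c, d] -> y \in `[c, d] ->
  `|inv_on `[b, +oo[ theta x - inv_on `[b, +oo[ theta y| <= L * `|x - y|.
Proof.
have [K bK dK] := theta_unbounded d; have [L L0 HL] := theta_ge K.
exists L => x y bx yb.
have [] := inv_on_spec (effective_surj bx).
have [] := inv_on_spec (effective_surj yb).
set u := inv_on _ _ x; set v := inv_on _ _ y => bv vy bu ux xcd ycd.
have inv_le w : `[b, +oo[%classic w -> theta w <= d -> w <= K.
  move=> bw wd; rewrite leNgt; apply/negP => /effective_lt.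
  by rewrite in_itv/= andbT => /(_ bK bw); lra.
have uK : u <= K by apply: inv_le => //; rewrite ux; case/andP: xcd.
have vK : v <= K by apply: inv_le => //; rewrite vy; case/andP: ycd.
move: bu bv; rewrite /= !in_itv/= !andbT => bu bv.
have [uv|vu|->] := ltgtP u v.
- have := HL _ _ bu uv vK; rewrite ux vy ltr0_norm ?subr_lt0// => H.
  have : L * (y - x) <= L * `|x - y| by rewrite ler_pM2l// distrC ler_norm.
  by lra.
- have := HL _ _ bv vu uK; rewrite ux vy gtr0_norm ?subr_gt0// => H.
  have : L * (x - y) <= L * `|x - y| by rewrite ler_pM2l// ler_norm.
  by lra.
- by rewrite subrr normr0 mulr_ge0// ltW.
Qed.

Lemma effective_inv_locally_lipschitz :
  locally_lipschitz_on `[theta b, +oo[ (inv_on `[b, +oo[ theta).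
Proof.
apply: lipschitz_segments_locally => c d.
have [L HL] := effective_inv_lipschitz c d; exists L => x y /=.
by rewrite !in_itv/= !andbT => bx yb; exact: HL.
Qed.

(** This and the next lemmas transfer the results to [- theta], the form that the mean slope of the
    decreasing branch takes after reflection. *)
Lemma effective_opp_inv y : theta b <= y ->
  inv_on `[b, +oo[ (\- theta) (- y) = inv_on `[b, +oo[ theta y.
Proof.
move=> /effective_surj ty; have [bu uy] := inv_on_spec ty.
have [|bv /oppr_inj vy] := @inv_on_spec _ `[b, +oo[ (\- theta) (- y).
  by case: ty => x bx <-; exists x.
by apply: effective_inj; rewrite // vy uy.
Qed.

Lemma effective_opp_continuous : {within `[b, +oo[, continuous (\- theta)}.
Proof. by move=> x; apply/continuousN/effective_continuous. Qed.

Lemma effective_opp_bij : set_bij `[b, +oo[ `]-oo, - theta b] (\- theta).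
Proof.
have [f i s] := effective_bij; split=> [x /f/=|x y bx yb /oppr_inj|y /=].
- by rewrite !in_itv/= !andbT lerN2.
- exact: i.
- rewrite in_itv/= lerNr => /effective_surj[x bx xy]; exists x => //=.
  by rewrite xy opprK.
Qed.

Lemma effective_opp_inv_locally_lipschitz :
  locally_lipschitz_on `]-oo, - theta b] (inv_on `[b, +oo[ (\- theta)).
Proof.
apply: lipschitz_segments_locally => c d.
have [L HL] := effective_inv_lipschitz (- d) (- c); exists L => x y /=.
rewrite !in_itv/= => bx yb xcd ycd.
have -> : `|x - y| = `|- x - - y| by rewrite -normrN; congr `| _ |; ring.
rewrite -{1}[x]opprK -{1}[y]opprK !effective_opp_inv; [|lra..].
by apply: HL; rewrite ?in_itv/=; lra.
Qed.

End effective.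

(** * Stationary random slopes *)

Section mean.
Context {R : realType} {d : measure_display} {Omega : measurableType d}.
Context {P : probability Omega R}.
Implicit Types X Y : Omega -> R.

Lemma meanE X : fine 'E_P[X]%E = Rintegral P setT X.
Proof. by rewrite unlock. Qed.

Lemma bounded_integrable X c :
  measurable_fun setT X -> (forall w, `|X w| <= c) ->
  P.-integrable setT (EFin \o X).
Proof.
move=> mX Xc; apply: measurable_bounded_integrable => //.
  by rewrite [X in (X < _)%E]probability_setT ltry.
by exists c; split; [exact: num_real|move=> x cx w _; rewrite /= (le_trans (Xc w))// ltW].
Qed.

Lemma cst_integrable (c : R) : P.-integrable setT (EFin \o cst c : Omega -> _).
Proof. by apply: (@bounded_integrable _ `|c|) => //; exact: measurable_cst. Qed.

Lemma mean_cst (c : R) : fine 'E_P[cst c]%E = c.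
Proof. by rewrite expectation_cst. Qed.

Lemma mean_le X Y c : P.-integrable setT (EFin \o X) ->
  P.-integrable setT (EFin \o Y) -> (forall w, X w <= Y w + c) ->
  fine 'E_P[X]%E <= fine 'E_P[Y]%E + c.
Proof.
move=> iX iY XY; rewrite !meanE -[c in leRHS]mean_cst meanE.
rewrite -RintegralD//; last exact: cst_integrable.
apply: le_Rintegral => //.
exact: (@integrableD _ _ _ P setT measurableT (EFin \o Y) (EFin \o cst c) iY (cst_integrable c)).
Qed.

Lemma mean_eq0 X : measurable_fun setT X -> P.-integrable setT (EFin \o X) ->
  (forall w, 0 <= X w) -> fine 'E_P[X]%E = 0 -> {ae P, forall w, X w = 0}.
Proof.
move=> mX iX X0; rewrite meanE /Rintegral => EX.
have {}EX : (\int[P]_w (X w)%:E = 0)%E.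
  by rewrite -[LHS]fineK ?EX//; exact: integrable_fin_num.
have : ae_eq P setT (EFin \o X) (cst 0%E).
  apply/ae_eq_integral_abs => //; first exact/measurable_EFinP.
  by rewrite -[RHS]EX; apply: eq_integral => w _; rewrite /= ger0_norm.
by apply: filterS => w /(_ I)[].
Qed.

(* [X - c] or [c - X] is nonnegative with mean zero. *)
Lemma mean_eq_cst X c l r : measurable_fun setT X -> (forall w, l <= X w <= r) ->
  fine 'E_P[X]%E = c -> c = l \/ c = r -> {ae P, forall w, X w = c}.
Proof.
move=> mX Xlr EX clr.
have iX : P.-integrable setT (EFin \o X).
  apply: (@bounded_integrable _ (`|l| + `|r|)) => // w.
  have := Xlr w; have := ler_norm r; have := ler_norm (- l); rewrite normrN.
  by have := normr_ge0 l; have := normr_ge0 r; rewrite ler_norml; lra.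
have [lX|Xr] : (forall w, c <= X w) \/ (forall w, X w <= c).
    by case: clr => ->; [left|right] => w; case/andP: (Xlr w).
- have : {ae P, forall w, X w - c = 0}; last first.
    by apply: filterS => w /eqP; rewrite subr_eq0 => /eqP.
  apply: (@mean_eq0 (fun w => X w - c)).
  + exact: measurable_funB.
  + exact: (@integrableB _ _ _ P setT measurableT (EFin \o X) (EFin \o cst c) iX (cst_integrable c)).
  + by move=> w; rewrite subr_ge0.
  + rewrite meanE RintegralB//; last exact: cst_integrable.
    by rewrite -!meanE mean_cst EX subrr.
- have : {ae P, forall w, c - X w = 0}; last first.
    by apply: filterS => w /eqP; rewrite subr_eq0 => /eqP.
  apply: (@mean_eq0 (fun w => c - X w)).
  + exact: measurable_funB.
  + exact: (@integrableB _ _ _ P setT measurableT (EFin \o cst c) (EFin \o X) (cst_integrable c) iX).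
  + by move=> w; rewrite subr_ge0.
  + rewrite meanE RintegralB//; last exact: cst_integrable.
    by rewrite -!meanE mean_cst EX subrr.
Qed.

Lemma ae_exists (Q : Omega -> Prop) : {ae P, forall w, Q w} -> exists w, Q w.
Proof.
move=> [N [mN PN QN]]; apply: contrapT => nQ.
suff : P setT = 0%E by rewrite probability_setT => /eqP; rewrite onee_eq0.
rewrite -PN; congr (P _); apply/seteqP; split=> w // _; apply: QN => /= Qw.
by apply: nQ; exists w.
Qed.

Lemma ae_flow (tau : R -> Omega -> Omega) (x : R) (Q : Omega -> Prop) :
  measure_preserving_flow P tau ->
  {ae P, forall w, Q w} -> {ae P, forall w, Q (tau x w)}.
Proof.
move=> [_ _ mtau tauP] [N [mN PN QN]]; exists (tau x @^-1` N); split.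
- rewrite -[X in measurable X]setTI.
  by apply: (measurable_fun_pair2 x mtau) => //.
- by rewrite tauP.
- by move=> w /= nQ; exact: QN.
Qed.

End mean.

(** Almost sure statements combine over countably many points only; continuity supplies the
    others. *)
Lemma continuous_eq_rat (R : realType) (f : R -> R) (c : R) :
  continuous f -> (forall q : rat, f (ratr q) = c) -> forall x, f x = c.
Proof.
move=> cf fq x; apply/eqP; rewrite -subr_eq0 -normr_eq0; apply: contrapT => /negP fx.
have fx0 : 0 < `|f x - c| by rewrite lt_neqAle eq_sym fx normr_ge0.
have /cvgrPdist_lt/(_ _ fx0)[e /= e0 He] := cf x.
have /rat_in_itvoo[q] : x - e < x + e by lra.
rewrite in_itv/= => xq; have := He (ratr q); rewrite fq ltxx /ball_/= => H.
by suff : false by []; apply: H; rewrite ltr_norml; lra.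
Qed.

Section random_slopes.
Context {R : realType} {d : measure_display} {Omega : measurableType d}.
Context {P : probability Omega R} {tau : R -> Omega -> Omega}.
Context {beta : R} {G : R -> R} {a V : R -> Omega -> R}.
Context {u : R -> R -> Omega -> R}.
Hypothesis tau_flow : measure_preserving_flow P tau.
Hypothesis beta_gt0 : 0 < beta.
Hypothesis G_lip : locally_lipschitz_on setT G.
Hypothesis G_pinfty : G p @[p --> +oo] --> +oo.
Hypothesis G_0 : G 0 = 0.
Hypothesis G2_incr : {in `[0, +oo[ &, {homo G : p q / p < q}}.
Hypothesis a_meas : measurable_fun setT (a 0).
Hypothesis V_meas : measurable_fun setT (V 0).
Hypothesis a_bound : forall x w, 0 < a x w <= 1.
Hypothesis a_stat : stationary tau a.
Hypothesis V_stat : stationary tau V.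
Hypothesis V_inf_sup : {ae P, forall w,
  inf (range (fun x => V x w)) = 0 /\ sup (range (fun x => V x w)) = 1}.
Hypothesis a_cont : forall w, continuous (fun x => a x w).
Hypothesis V_cont : forall w, continuous (fun x => V x w).
Hypothesis u_eq : forall lam w, beta <= lam ->
  slope_eq G (a ^~ w) (fun x => beta * V x w) lam (u lam ^~ w).
Hypothesis u_itv : forall lam x w, beta <= lam ->
  G2inv G (lam - beta) <= u lam x w <= G2inv G lam.

Let cG : continuous G := locally_lipschitz_continuous G_lip.

Let G2inv_spec l : 0 <= l -> 0 <= G2inv G l /\ G (G2inv G l) = l.
Proof.
move=> l0; have [] := inv_on_spec (surj_nonneg cG G_pinfty G_0 l0).
by rewrite /= in_itv/= andbT.
Qed.

Let G2inv_le l1 l2 : 0 <= l1 -> l1 <= l2 -> G2inv G l1 <= G2inv G l2.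
Proof.
move=> l10 l12; have [p0 Gp] := G2inv_spec l10.
have [q0 Gq] := G2inv_spec (le_trans l10 l12).
rewrite leNgt; apply/negP => /G2_incr; rewrite !in_itv/= p0 q0 Gp Gq.
by move=> /(_ isT isT); lra.
Qed.

(** One interval for all [lam <= K], so that the Lipschitz and gap constants of [G] can be chosen
    uniformly in [lam]. *)
Let u_bound K lam x w : beta <= lam -> lam <= K -> 0 <= u lam x w <= G2inv G K.
Proof.
move=> bl lK; have /andP[lu ul] := u_itv x w bl.
have bl0 : 0 <= lam - beta by rewrite subr_ge0.
have [p0 _] := G2inv_spec bl0.
have := G2inv_le (le_trans (ltW beta_gt0) bl) lK; lra.
Qed.

Lemma measurable_stationary (f : R -> Omega -> R) :
  stationary tau f -> measurable_fun setT (f 0) ->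
  forall x, measurable_fun setT (f x).
Proof.
move=> fs mf x; rewrite (_ : f x = f 0 \o tau x).
  apply: measurableT_comp => //; case: tau_flow => _ _ mtau _.
  exact: (measurable_fun_pair2 x mtau).
by apply/funext => w; exact: fs.
Qed.

Lemma slope_measurable lam : beta <= lam -> measurable_fun setT (u lam 0).
Proof.
move=> bl; apply: (@measurable_slope _ _ _ G a (fun x w => beta * V x w) _ lam
  (G2inv G lam)) => //.
- exact: measurable_stationary.
- move=> x; apply: measurable_funM; first exact: measurable_cst.
  exact: measurable_stationary.
- by move=> w x; apply: cvgM; [exact: cvg_cst|exact: V_cont].
- by move=> w; exact: u_eq.
- by move=> x w; exact: u_bound.
Qed.

Lemma slope_integrable lam :
  beta <= lam -> P.-integrable setT (EFin \o u lam 0).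
Proof.
move=> bl; apply: (@bounded_integrable _ _ _ _ _ (G2inv G lam)).
  exact: slope_measurable.
by move=> w; have /andP[u0 uK] := u_bound 0 w bl (lexx _); rewrite ger0_norm.
Qed.

Let stationary_shift (f : R -> Omega -> R) x y w :
  stationary tau f -> f (x + y) w = f y (tau x w).
Proof.
by move=> fs; rewrite fs [RHS]fs addrC; case: tau_flow => _ -> _ _.
Qed.

(* The slope shifted by [x] and the slope in the environment [tau x w] solve the
   same equation. *)
Lemma slope_stationary lam : beta <= lam -> stationary tau (u lam).
Proof.
move=> bl x w.
have shift_eq : slope_eq G (a ^~ (tau x w)) (fun y => beta * V y (tau x w)) lam
    (fun y => u lam (x + y) w).
  move=> y; have [du eu] := u_eq w bl (x + y).
  have dx : is_derive y 1 (fun y => u lam (x + y) w) (derive1 (u lam ^~ w) (x + y)).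
    have dshift : is_derive y 1 (fun y => x + y) 1.
      by apply: DeriveDef => //; rewrite deriveD// derive_cst derive_id add0r.
    rewrite -[derive1 _ _]mulr1.
    exact: (is_derive1_comp (is_derive_derive1 du) dshift).
  split; first exact: ex_derive.
  by rewrite derive1E derive_val -!stationary_shift// -eu.
have u_unique := @slope_eq_unique _ G _ _ (G2inv G lam) lam _ _ cG G2_incr
  (a_bound ^~ (tau x w)) shift_eq (u_eq (tau x w) bl).
have := u_unique (fun y => u_bound (x + y) w bl (lexx _))
  (fun y => u_bound y (tau x w) bl (lexx _)).
by move=> /(congr1 (@^~ 0)); rewrite addr0.
Qed.

(* A slope which is a.e. constant would force [V] to be constant. *)
Lemma slope_not_ae_cst lam c : beta <= lam ->
  ~ {ae P, forall w, u lam 0 w = c}.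
Proof.
move=> bl uc.
(* The rationals are enumerated by [unpickle], with 0 for codes of no rational, to obtain a single
   null set. *)
have : {ae P, forall w, forall n : nat,
    u lam (ratr (odflt 0 (unpickle n) : rat)) w = c}.
  apply: ae_foralln => n.
  have := ae_flow (ratr (odflt 0 (unpickle n))) tau_flow uc.
  by apply: filterS => w <-; exact: slope_stationary.
move=> /(filterI V_inf_sup)/ae_exists[w [[Vinf Vsup] uw]].
have {}uw x : u lam x w = c.
  apply: (@continuous_eq_rat _ (u lam ^~ w)).
    exact: slope_eq_continuous (u_eq w bl).
  by move=> q; have := uw (pickle q); rewrite pickleK.
have Vc : (fun x => V x w) = cst ((lam - G c) / beta).
  apply/funext => x /=; have [_] := u_eq w bl x.
  rewrite (_ : u lam ^~ w = cst c); last exact/funext.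
  rewrite derive1_cst mulr0 add0r /= uw => <-.
  by field; rewrite gt_eqF.
have rangeV : range (fun x => V x w) = [set (lam - G c) / beta].
  by rewrite Vc; apply/seteqP; split=> [_ [x _ <-]//|_ ->]; exists 0.
by move: Vinf Vsup; rewrite rangeV inf1 sup1 => -> /eqP; rewrite eq_sym oner_eq0.
Qed.

Let mean lam := fine 'E_P[u lam 0]%E.

Lemma slope_mean_itv lam : beta <= lam ->
  mean lam \in `]G2inv G (lam - beta), G2inv G lam[.
Proof.
move=> bl; set m := G2inv G (lam - beta); set M := G2inv G lam.
have mu := slope_measurable bl; have iu := slope_integrable bl.
have uK w : m <= u lam 0 w <= M by exact: u_itv.
have mmean : m <= mean lam.
  rewrite -[m](@mean_cst _ _ _ P) -[leRHS]addr0; apply: mean_le => //.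
    exact: cst_integrable.
  by move=> w; rewrite addr0; case/andP: (uK w).
have meanM : mean lam <= M.
  rewrite -[M](@mean_cst _ _ _ P) -[leRHS]addr0; apply: mean_le => //.
    exact: cst_integrable.
  by move=> w; rewrite addr0; case/andP: (uK w).
(* A mean equal to an end of the interval would make the slope a.e. constant. *)
rewrite in_itv/= !lt_neqAle mmean meanM !andbT; apply/andP; split; apply/eqP => E.
- apply: (@slope_not_ae_cst lam m) => //; apply: (mean_eq_cst mu uK); first exact/esym.
  by left.
- by apply: (@slope_not_ae_cst lam M) => //; apply: (mean_eq_cst mu uK) => //; right.
Qed.

Lemma slope_mean_ge K : exists2 L, 0 < L & forall l1 l2,
  beta <= l1 -> l1 < l2 -> l2 <= K -> l2 - l1 <= L * (mean l2 - mean l1).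
Proof.
have [L L0 GL] := locally_lipschitz_segment 0 (G2inv G K) G_lip.
exists (2 * L) => [|l1 l2 bl1 l12 l2K]; first by rewrite mulr_gt0.
have bl2 : beta <= l2 by lra.
rewrite mulrC -ler_pdivrMr ?mulr_gt0// lerBrDl -lerBrDr.
apply: mean_le; [exact: slope_integrable..|] => w.
rewrite lerBrDr.
apply: (slope_eq_ge (a_bound ^~ w) (u_eq w bl1) (u_eq w bl2) _ _ L0 GL G2_incr l12).
- by move=> x; apply: u_bound => //; lra.
- by move=> x; exact: u_bound.
Qed.

Lemma slope_mean_le K e : 0 < e -> exists2 c, 0 < c & forall l1 l2,
  beta <= l1 <= K -> beta <= l2 <= K -> l2 - l1 < c -> mean l2 <= mean l1 + e.
Proof.
move=> e0; have [c c0 gap] := increasing_gap (G2inv G K) cG G2_incr e0.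
exists c => // l1 l2 /andP[bl1 l1K] /andP[bl2 l2K] l12.
apply: mean_le; [exact: slope_integrable..|] => w.
by apply: (slope_eq_le (a_bound ^~ w) (u_eq w bl1) (u_eq w bl2) _ _ gap l12) => x;
  exact: u_bound.
Qed.

(** For [lam = G p + beta] the lower end of the slope interval is the preimage of [G p], hence at
    least [p]. *)
Lemma slope_mean_unbounded M : exists2 l, beta <= l & M <= mean l.
Proof.
pose p := Num.max M 0.
have p0 : 0 <= p by rewrite le_max lexx orbT.
have Gp : 0 <= G p.
  move: p0; rewrite le_eqVlt => /predU1P[<-|p0]; first by rewrite G_0.
  by rewrite -G_0 ltW// G2_incr// in_itv/= ?lexx ?ltW.
have bl : beta <= G p + beta by rewrite lerDr.
exists (G p + beta) => //; have := slope_mean_itv bl.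
rewrite in_itv/= addrK => /andP[+ _]; move/ltW; apply: le_trans.
have [q0 Gq] := G2inv_spec Gp; apply: (@le_trans _ _ p); first by rewrite le_max lexx.
rewrite leNgt; apply/negP => /G2_incr; rewrite !in_itv/= p0 q0 Gq.
by move=> /(_ isT isT); rewrite ltxx.
Qed.

(** Collected in one statement because it is applied twice: to the increasing branch and to the
    reflected decreasing one. *)
Lemma slope_mean_effective :
  [/\ forall lam, beta <= lam ->
       mean lam \in `]G2inv G (lam - beta), G2inv G lam[,
     forall K, exists2 L, 0 < L & forall l1 l2, beta <= l1 -> l1 < l2 ->
       l2 <= K -> l2 - l1 <= L * (mean l2 - mean l1),
     forall K e : R, 0 < e -> exists2 c, 0 < c & forall l1 l2,
       beta <= l1 <= K -> beta <= l2 <= K -> l2 - l1 < c ->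
       mean l2 <= mean l1 + e &
     forall M, exists2 l, beta <= l & M <= mean l].
Proof.
split; [exact: slope_mean_itv|exact: slope_mean_ge|exact: slope_mean_le|].
exact: slope_mean_unbounded.
Qed.

End random_slopes.

(** * Reflection of the decreasing branch *)

Lemma corrector_slope_eq (R : realType) (beta : R) (G a V : R -> R) (lam : R)
    (I : interval R) (F : R -> R) :
  corrector beta G a V lam I F ->
  slope_eq G a (fun x => beta * V x) lam (derive1 F).
Proof. by move=> [[_ dF _] _ _ eF] x; split; [exact: dF|exact: eF]. Qed.

(** The two sign changes cancel in the derivative, so the equation keeps its form and only [G] is
    reflected in its argument. *)
Lemma slope_eq_reflect (R : realType) (G a W : R -> R) (lam : R) (u : R -> R) :
  slope_eq G a W lam u ->
  slope_eq (fun p => G (- p)) (fun x => a (- x)) (fun x => W (- x)) lam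
    (fun x => - u (- x)).
Proof.
move=> eu x; have [du ex] := eu (- x).
have dopp : is_derive x 1 (fun x => - x) (- 1).
  by apply: DeriveDef; rewrite ?deriveN ?derive_id//; exact: derivableN.
have := is_derive1_comp (is_derive_derive1 du) dopp.
rewrite mulrN1 => dcomp.
have dN : is_derive x 1 (fun x => - u (- x)) (derive1 u (- x)).
  by rewrite -[derive1 u _]opprK; exact: is_deriveN.
by split; [exact: ex_derive|rewrite derive1E derive_val opprK].
Qed.

Lemma reflect_flow (R : realType) (d : measure_display) (Omega : measurableType d)
    (P : probability Omega R) (tau : R -> Omega -> Omega) :
  measure_preserving_flow P tau ->
  measure_preserving_flow P (fun x => tau (- x)).
Proof.
move=> [tau0 tauD mtau tauP]; split.
- by rewrite oppr0.
- by move=> x y; rewrite opprD.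
- apply: (measurableT_comp mtau (g := fun z : R * Omega => (- z.1, z.2))).
  by apply: measurable_fun_pair => //; apply: measurableT_comp.
- by move=> x; exact: tauP.
Qed.

Lemma G1inv_reflect (R : realType) (G : R -> R) (l : R) :
  continuous G -> G p @[p --> -oo] --> +oo -> G 0 = 0 ->
  {in `]-oo, 0] &, {homo G : p q / p < q >-> q < p}} -> 0 <= l ->
  G1inv G l = - G2inv (fun p => G (- p)) l.
Proof.
move=> cG Gy G0 decr l0.
have cGN : continuous (fun p => G (- p)).
  by move=> p; apply: continuous_comp; [exact: opp_continuous|exact: cG].
have surjN : ((fun p => G (- p)) @` `[0, +oo[) l.
  by apply: surj_nonneg => //; [exact/cvgNy_compNP|rewrite oppr0].
have [] := inv_on_spec surjN; rewrite -/(G2inv _ l); set q := G2inv _ l.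
rewrite /= in_itv/= andbT => q0 Gq.
have [|] := @inv_on_spec _ `]-oo, 0] G l.
  by exists (- q) => //=; rewrite in_itv/= oppr_le0.
rewrite -/(G1inv G l); set p := G1inv _ l; rewrite /= in_itv/= => p0 Gp.
(* Both [p] and [- q] are preimages of [l] in []-oo, 0]], where [G] is injective. *)
apply/eqP; case: ltgtP => // /decr; rewrite !in_itv/= oppr_le0 p0 q0 Gp Gq ltxx;
  by move=> /(_ isT isT).
Qed.

(* Also true when [X] is not integrable: [fine] maps both infinities to 0. *)
Lemma mean_opp (R : realType) (d : measure_display) (Omega : measurableType d)
    (P : probability Omega R) (X : Omega -> R) :
  fine 'E_P[\- X]%E = - fine 'E_P[X]%E.
Proof.
rewrite unlock integralE [in RHS]integralE.
have -> : (fun w => (- X w)%:E) = (\- (fun w => (X w)%:E))%E by [].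
rewrite funeposN funenegN.
have pos : (0 <= \int[P]_w ((fun w => (X w)%:E)^\+ w))%E by exact: integral_ge0.
have neg : (0 <= \int[P]_w ((fun w => (X w)%:E)^\- w))%E by exact: integral_ge0.
move: pos neg; move: (integral P _ _) (integral P _ _).
by move=> [r||] [t||] //= _ _; rewrite ?oppr0// opprB.
Qed.

Unset Implicit Arguments.
Set Strict Implicit.

Theorem theorem2p2 (R : realType) (d : measure_display)
    (Omega : measurableType d) (P : probability Omega R)
    (tau : R -> Omega -> Omega)
    (tau_flow : measure_preserving_flow P tau)
    (P_ergodic : ergodic P tau)
    (beta : R) (beta_gt0 : 0 < beta)
    (G : R -> R) (a V : R -> Omega -> R)
    (G_ge0 : forall p, 0 <= G p)
    (G_lip : locally_lipschitz_on setT G)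
    (G_pinfty : G p @[p --> +oo] --> +oo)
    (G_ninfty : G p @[p --> -oo] --> +oo)
    (G_0 : G 0 = 0)
    (G1_decr : {in `]-oo, 0] &, {homo G : p q / p < q >-> q < p}})
    (G2_incr : {in `[0, +oo[ &, {homo G : p q / p < q}})
    (a_meas : measurable_fun setT (a 0))
    (V_meas : measurable_fun setT (V 0))
    (a_bound : forall x w, 0 < a x w <= 1)
    (V_bound : forall x w, 0 <= V x w <= 1)
    (a_stat : stationary tau a)
    (V_stat : stationary tau V)
    (V_inf_sup : {ae P, forall w,
       inf (range (fun x => V x w)) = 0 /\ sup (range (fun x => V x w)) = 1})
    (a_cont : forall w, continuous (fun x => a x w))
    (V_cont : forall w, continuous (fun x => V x w))
    (F1 F2 : R -> R -> Omega -> R)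
    (F1_sol : forall lam w, beta <= lam ->
       corrector beta G (fun x => a x w) (fun x => V x w) lam
         `[G1inv G lam, G1inv G (lam - beta)] (fun x => F1 lam x w))
    (F2_sol : forall lam w, beta <= lam ->
       corrector beta G (fun x => a x w) (fun x => V x w) lam
         `[G2inv G (lam - beta), G2inv G lam] (fun x => F2 lam x w)) :
  let theta1 := theta P F1 in
  let theta2 := theta P F2 in
  (forall lam, beta <= lam ->
     (theta1 lam \in `]G1inv G lam, G1inv G (lam - beta)[) /\
     (theta2 lam \in `]G2inv G (lam - beta), G2inv G lam[)) /\
  (set_bij `[beta, +oo[ `]-oo, theta1 beta] theta1 /\
   {within `[beta, +oo[, continuous theta1} /\
   {in `[beta, +oo[ &, {homo theta1 : x y / x < y >-> y < x}}) /\
  (set_bij `[beta, +oo[ `[theta2 beta, +oo[ theta2 /\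
   {within `[beta, +oo[, continuous theta2} /\
   {in `[beta, +oo[ &, {homo theta2 : x y / x < y}}) /\
  (locally_lipschitz_on `]-oo, theta1 beta] (inv_on `[beta, +oo[ theta1) /\
   locally_lipschitz_on `[theta2 beta, +oo[ (inv_on `[beta, +oo[ theta2)).
Proof.
have cG : continuous G := locally_lipschitz_continuous G_lip.
move=> theta1 theta2.
pose u2 lam x w := derive1 (fun x => F2 lam x w) x.
have u2_eq lam w : beta <= lam ->
    slope_eq G (a ^~ w) (fun x => beta * V x w) lam (u2 lam ^~ w).
  by move=> bl; exact: corrector_slope_eq (F2_sol lam w bl).
have u2_itv lam x w : beta <= lam -> G2inv G (lam - beta) <= u2 lam x w <= G2inv G lam.
  by move=> bl; have [_ _ /(_ x) + _] := F2_sol lam w bl; rewrite in_itv.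
have [itv2 ge2 le2 unb2] := slope_mean_effective tau_flow beta_gt0 G_lip G_pinfty
  G_0 G2_incr a_meas V_meas a_bound a_stat V_stat V_inf_sup a_cont V_cont u2_eq u2_itv.
(* Reflected data: the slopes [u1] are nonnegative and live on the increasing branch of [GN], in an
   environment stationary under the reversed flow. *)
pose GN p := G (- p); pose aN x w := a (- x) w; pose VN x w := V (- x) w.
pose u1 lam x w := - derive1 (fun x => F1 lam x w) (- x).
have reflect_stat f : stationary tau f ->
    stationary (fun x => tau (- x)) (fun x w => f (- x) w).
  by move=> fs x w; rewrite oppr0 fs.
have reflect_meas (f : R -> Omega -> R) :
    measurable_fun setT (f 0) -> measurable_fun setT (f (- 0)) by rewrite oppr0.
have reflect_cont (f : R -> R) : continuous f -> continuous (fun x => f (- x)).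
  by move=> cf x; apply: continuous_comp; [exact: opp_continuous|exact: cf].
have GN_lip : locally_lipschitz_on setT GN.
  apply: lipschitz_segments_locally => c e.
  have [L L0 HL] := locally_lipschitz_segment (- e) (- c) G_lip.
  exists L => x y _ _ xce yce.
  have -> : `|x - y| = `|- x - - y| by rewrite -normrN; congr `| _ |; ring.
  by apply: HL; move: xce yce; rewrite !in_itv/=; lra.
have VN_inf_sup : {ae P, forall w,
    inf (range (fun x => VN x w)) = 0 /\ sup (range (fun x => VN x w)) = 1}.
  apply: filterS V_inf_sup => w.
  suff -> : range (fun x => VN x w) = range (fun x => V x w) by [].
  by apply/seteqP; split=> _ [x _ <-]; exists (- x) => //; rewrite /VN ?opprK.
have GN_incr : {in `[0, +oo[ &, {homo GN : p q / p < q}}.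
  move=> p q p0 q0 pq; apply: G1_decr; rewrite ?ltrN2//.
    by move: q0; rewrite !in_itv/= andbT oppr_le0.
  by move: p0; rewrite !in_itv/= andbT oppr_le0.
have u1_eq lam w : beta <= lam ->
    slope_eq GN (aN ^~ w) (fun x => beta * VN x w) lam (u1 lam ^~ w).
  by move=> bl; exact: slope_eq_reflect (corrector_slope_eq (F1_sol lam w bl)).
have G1E l : 0 <= l -> G1inv G l = - G2inv GN l by exact: G1inv_reflect.
have u1_itv lam x w : beta <= lam ->
    G2inv GN (lam - beta) <= u1 lam x w <= G2inv GN lam.
  move=> bl; have [_ _ /(_ (- x)) + _] := F1_sol lam w bl.
  by rewrite in_itv/= !G1E ?subr_ge0// /u1; lra.
have tauN_flow := reflect_flow tau_flow.
have [itv1 ge1 le1 unb1] := slope_mean_effective tauN_flow beta_gt0 GN_lip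
  ((cvgNy_compNP _ _).1 G_ninfty) (etrans (congr1 G (oppr0 _)) G_0) GN_incr
  (reflect_meas a a_meas) (reflect_meas V V_meas) (fun x w => a_bound (- x) w)
  (reflect_stat a a_stat) (reflect_stat V V_stat) VN_inf_sup
  (fun w => reflect_cont _ (a_cont w)) (fun w => reflect_cont _ (V_cont w))
  u1_eq u1_itv.
(* At the origin reflection only changes the sign of the slope, so [theta1] is minus an increasing
   mean slope. *)
have theta1E : theta1 = \- (fun lam => fine (expectation P (u1 lam 0))).
  apply/funext => lam /=; rewrite -mean_opp; congr (fine (expectation P _)).
  by apply/funext => w; rewrite /u1 /= opprK oppr0.
split; last split; last split.
- move=> lam bl; split; last exact: itv2.
  have := itv1 lam bl; rewrite theta1E !in_itv/= !G1E ?subr_ge0//; lra.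
- rewrite theta1E; split; first exact: effective_opp_bij ge1 le1 unb1.
  split; first exact: effective_opp_continuous le1.
  by move=> x y bx yb xy; rewrite ltrN2; exact: (effective_lt ge1).
- split; first exact: effective_bij ge2 le2 unb2.
  by split; [exact: effective_continuous le2|exact: effective_lt ge2].
- split; last exact: effective_inv_locally_lipschitz ge2 le2 unb2.
  by rewrite theta1E; exact: effective_opp_inv_locally_lipschitz ge1 le1 unb1.
Qed.
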